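(* Let $G$ be a median graph with basepoint $v_0$. Let $u\in V$, let $L$ be a POF outgoing from $u$, let $Q$ be the hypercube with basis $u$ and signature $L$, and let $u^+$ be the anti-basis of $Q$. A vertex $v\neq u^+$ satisfies both $u\in I(v_0,v)$ and $L_{u,v}=L$ if and only if (i) $u^+\in I(v_0,v)$ and (ii) for each $E_j\in L_{u^+,v}$, the set $L\cup\{E_j\}$ is not a POF.
   Context: $G=(V,E)$ is a finite, simple, connected, undirected median graph: for all vertices $x,y,z$ the set $I(x,y)\cap I(y,z)\cap I(z,x)$ has exactly one element, where $I(u,v)=\{w: d(u,w)+d(w,v)=d(u,v)\}$. Edges $uv,xy$ are in relation $\Theta_0$ if $uvyx$ is a 4-cycle; $\Theta$ is the reflexive transitive closure of $\Theta_0$, with equivalence classes ($\Theta$-classes). For each class $E_i$, $(V,E\setminus E_i)$ has exactly two connected components (halfspaces). Classes $E_i,E_j$ are orthogonal if there is a 4-cycle $uvyx$ with $uv,xy\in E_i$, $ux,vy\in E_j$; a POF (pairwise orthogonal family) is a set of classes any two distinct members of which are orthogonal. A basepoint $v_0$ is fixed and each edge $xy$ is oriented from $x$ to $y$ when $d(v_0,x)<d(v_0,y)$. A POF $L$ is outgoing from $u$ if every class of $L$ has an edge oriented out of $u$; then there is a unique induced hypercube with basis $u$ (its vertex closest to $v_0$) whose edges have exactly the classes of $L$, called the hypercube with basis $u$ and signature $L$; its anti-basis is its vertex farthest from $v_0$. The signature $\sigma_{x,y}$ is the set of classes separating $x$ and $y$ (i.e. $x,y$ in different halfspaces). For $x\in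 I(v_0,y)$ the ladder set $L_{x,y}$ is the set of classes in $\sigma_{x,y}$ having an edge incident to $x$. *)

(* Defs.v *)
From mathcomp Require Import all_boot.

Set Implicit Arguments.
Unset Strict Implicit.
Unset Printing Implicit Defensive.

Section MedianGraphs.

Variables (T : finType) (e : rel T).

Definition has_walk (x y : T) (n : nat) : bool :=
  [exists p : n.-tuple T, path e x p && (last x p == y)].

(* Least length of a walk from x to y. A shortest walk has fewer than #|T|
   edges; the junk value #|T| is only returned when y is unreachable. *)
Definition dist (x y : T) : nat := find (has_walk x y) (iota 0 #|T|).

Definition interval (x y : T) : {set T} :=
  [set z | dist x z + dist z y == dist x y].

Definition simple_graph : Prop := symmetric e /\ irreflexive e.

Definition connected_graph : Prop := forall x y, connect e x y.

Definition median_graph : Prop :=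
  [/\ simple_graph, connected_graph
    & forall x y z,
        #|interval x y :&: interval y z :&: interval z x| = 1].

Definition edges : {set {set T}} :=
  [set [set p.1; p.2] | p : T * T & e p.1 p.2].

Definition four_cycle (a b c d : T) : bool :=
  uniq [:: a; b; c; d] && cycle e [:: a; b; c; d].

Definition theta0 (A B : {set T}) : bool :=
  [exists u, exists v, exists x, exists y,
     [&& four_cycle u v y x, A == [set u; v] & B == [set x; y]]].

Definition theta : rel {set T} := connect theta0.

Definition theta_classes : {set {set {set T}}} :=
  equivalence_partition theta edges.

Definition orthogonal (C D : {set {set T}}) : bool :=
  [exists u, exists v, exists x, exists y,
     [&& four_cycle u v y x, [set u; v] \in C, [set x; y] \in C,
         [set u; x] \in D & [set v; y] \in D]].

Definition POF (L : {set {set {set T}}}) : bool :=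
  (L \subset theta_classes) &&
  [forall C in L, forall D in L, (C != D) ==> orthogonal C D].

Definition remove_class (C : {set {set T}}) : rel T :=
  fun x y => e x y && ([set x; y] \notin C).

(* The halfspaces of C are the connected components of [remove_class C]. *)
Definition separates (C : {set {set T}}) (x y : T) : bool :=
  ~~ connect (remove_class C) x y.

Definition signature (x y : T) : {set {set {set T}}} :=
  [set C in theta_classes | separates C x y].

Definition ladder (x y : T) : {set {set {set T}}} :=
  [set C in signature x y | [exists A in C, x \in A]].

(* A cube is represented by its vertex set. *)
Definition induced_hypercube (Q : {set T}) : Prop :=
  exists k, exists f : {ffun 'I_k -> bool} -> T,
    [/\ injective f, [set f a | a in {ffun 'I_k -> bool}] = Q
      & forall a b, e (f a) (f b) = (#|[set i | a i != b i]| == 1)].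

Definition cube_signature (Q : {set T}) : {set {set {set T}}} :=
  [set C in theta_classes | [exists A in C, A \subset Q]].

Section Basepoint.

Variable v0 : T.

Definition oriented (x y : T) : bool := e x y && (dist v0 x < dist v0 y).

Definition outgoing (L : {set {set {set T}}}) (u : T) : bool :=
  [forall C in L, exists x, oriented u x && ([set u; x] \in C)].

Definition basis (Q : {set T}) (u : T) : Prop :=
  u \in Q /\ forall x, x \in Q -> dist v0 u <= dist v0 x.

Definition anti_basis (Q : {set T}) (u : T) : Prop :=
  u \in Q /\ forall x, x \in Q -> dist v0 x <= dist v0 u.

Definition hypercube_with (u : T) (L : {set {set {set T}}}) (Q : {set T}) :
    Prop :=
  [/\ induced_hypercube Q, basis Q u & cube_signature Q = L].

End Basepoint.

End MedianGraphs.

(* Main.v *)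
(* For an edge pq let W(p,q) be the set of vertices closer to p than to q. In a
   median graph opposite edges of a square define the same halfspaces, and the
   Theta-class of pq consists of exactly the edges leaving W(p,q); so C lies in
   L_{x,y} iff x has an edge xz in C with z closer to y. Two such edges at x
   whose other ends are both closer to y span a square, by taking a median.
   This has two consequences: the classes of a ladder set are pairwise
   orthogonal, and an edge whose class is orthogonal to all classes of Q can be
   slid along Q, through squares, without changing its halfspaces.
   If L_{u,v} = L then every direction of Q at u leads towards v, hence
   u+ is in I(u,v), and a class of L_{u+,v} orthogonal to L would slide back to
   u and enter L_{u,v} = L, although no class of L separates u+ from v.
   Conversely, if u+ is in I(v0,v) then L is contained in L_{u,v}, and any
   further class of L_{u,v} is orthogonal to L and slides to u+, against
   (ii). *)
Require Import Defs.
From mathcomp Require Import all_boot.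
From mathcomp Require Import zify.

Set Implicit Arguments.
Unset Strict Implicit.
Unset Printing Implicit Defensive.

Lemma set2_inj (T : finType) (a b c d : T) : [set a; b] = [set c; d] ->
  (a = c /\ b = d) \/ (a = d /\ b = c).
Proof.
move=> E.
have Ha : a \in [set c; d] by rewrite -E set21.
have Hb : b \in [set c; d] by rewrite -E set22.
have Hc : c \in [set a; b] by rewrite E set21.
have Hd : d \in [set a; b] by rewrite E set22.
by move: Ha Hb Hc Hd; rewrite !inE;
  do 4![case/orP=> /eqP ?]; subst; auto.
Qed.

(** * Walk distance as a graph metric *)

Section Distance.

Variables (T : finType) (e : rel T).
Hypothesis e_sym : symmetric e.
Hypothesis e_conn : connected_graph e.

Local Notation d := (dist e).

Lemma has_walkP x y n :
  reflect (exists p, [/\ size p = n, path e x p & last x p = y])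
          (has_walk e x y n).
Proof.
apply: (iffP existsP) => [[p /andP[xp /eqP <-]]|[p [sz xp <-]]].
  by exists p; split; rewrite ?size_tuple.
by move/eqP: sz => sz; exists (Tuple sz); rewrite /= xp eqxx.
Qed.

Lemma dist_le x y n : has_walk e x y n -> d x y <= n.
Proof.
(* For n at least [#|T|] the bound holds whether or not the search succeeds, since [find] never
   exceeds the length of the list. *)
move=> w; have [lt_n|le_n] := ltnP n #|T|; last first.
  by apply: leq_trans le_n; rewrite -[X in _ <= X](size_iota 0) find_size.
rewrite leqNgt; apply/negP => /(before_find 0).
by rewrite nth_iota // add0n w.
Qed.

(** Connectedness gives a walk, which shortens to one without repeated vertices; its length is below
    [#|T|], so the search succeeds and the default value is not reached. *)
Lemma dist_walk x y : has_walk e x y (d x y).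
Proof.
have has_w : has (has_walk e x y) (iota 0 #|T|).
  have /connectP[p xp ->] := e_conn x y.
  have [q xq uq _] := shortenP xp.
  apply/hasP; exists (size q); last by apply/has_walkP; exists q.
  rewrite mem_iota /= add0n.
  by have := max_card (mem (x :: q)); rewrite (card_uniqP uq).
have := nth_find 0 has_w; rewrite nth_iota ?add0n //.
by rewrite -[X in _ < X](size_iota 0) -has_find.
Qed.

Lemma distxx x : d x x = 0.
Proof. by apply/eqP; rewrite -leqn0; apply/dist_le/has_walkP; exists nil. Qed.

Lemma dist_eq0 x y : d x y = 0 -> x = y.
Proof.
move=> d0; have := dist_walk x y; rewrite d0.
by case/has_walkP=> p [/size0nil -> _ <-].
Qed.

Lemma dist_edge_le x y : e x y -> d x y <= 1.
Proof. by move=> xy; apply/dist_le/has_walkP; exists [:: y]; rewrite /= xy. Qed.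

Lemma dist_triangle y x z : d x z <= d x y + d y z.
Proof.
have /has_walkP[p [sp xp lp]] := dist_walk x y.
have /has_walkP[q [sq yq lq]] := dist_walk y z.
apply/dist_le/has_walkP; exists (p ++ q).
by rewrite size_cat sp sq cat_path last_cat lp xp.
Qed.

Lemma dist_sym x y : d x y = d y x.
Proof.
suff le x' y' : d x' y' <= d y' x' by apply/eqP; rewrite eqn_leq !le.
have /has_walkP[p [sp xp lp]] := dist_walk y' x'.
apply/dist_le/has_walkP; exists (rev (belast y' p)).
rewrite size_rev size_belast sp -[in path _ _ _]lp rev_path; split=> //.
  by rewrite (eq_path (e' := e)) // => a b; rewrite e_sym.
by case: p {sp xp} lp => [//|a p] _; rewrite /= rev_cons last_rcons.
Qed.

Lemma dist_step x y n : d x y = n.+1 -> exists2 z, e x z & d z y = n.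
Proof.
move=> dn; have := dist_walk x y; rewrite dn.
case/has_walkP=> [[[]//|z p] /= [[sp] /andP[xz zp] lp]].
exists z => //; apply/eqP; rewrite eqn_leq; apply/andP; split.
  by apply/dist_le/has_walkP; exists p.
by have := dist_triangle z x y; have := dist_edge_le xz; lia.
Qed.

Lemma dist1_edge x y : d x y = 1 -> e x y.
Proof. by move/dist_step=> [z xz /dist_eq0 <-]. Qed.

Lemma dist_edge z x y : e x y -> d z y <= (d z x).+1.
Proof. by move=> /dist_edge_le; have := dist_triangle x z y; lia. Qed.

End Distance.

(** Membership of z in W(p,q). The inequality is strict; that W(p,q) and W(q,p) are complementary
    for an edge pq comes from bipartiteness, in [closerN]. *)
Definition closer (T : finType) (e : rel T) (p q z : T) : bool :=
  dist e z p < dist e z q.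

(** * Coordinate flips and Hamming distance *)

Definition flip (k : nat) (i : 'I_k) (a : {ffun 'I_k -> bool}) :
    {ffun 'I_k -> bool} := [ffun j => (j == i) (+) a j].

Lemma flipE k (i : 'I_k) a j : flip i a j = (j == i) (+) a j.
Proof. by rewrite ffunE. Qed.

Lemma flipK k (i : 'I_k) : involutive (flip i).
Proof. by move=> a; apply/ffunP=> j; rewrite !flipE addbA addbb. Qed.

Lemma flipC k (i j : 'I_k) a : flip i (flip j a) = flip j (flip i a).
Proof. by apply/ffunP=> l; rewrite !flipE addbCA. Qed.

Lemma card_flip k (i : 'I_k) (a b : {ffun 'I_k -> bool}) : b i = a i ->
  #|[set j | flip i b j != a j]| = #|[set j | b j != a j]|.+1.
Proof.
move=> ba; rewrite (cardsD1 i) inE flipE eqxx ba; case: (a i) => /=;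
  congr _.+1; apply: eq_card => j; rewrite !inE flipE;
  by case: eqVneq => [->|]; rewrite ?ba ?eqxx.
Qed.

(** Induction on the Hamming distance from [a]: only a coordinate still agreeing with [a] is
    flipped, so each step moves one edge away from [a]. *)
Lemma cube_ind k (a : {ffun 'I_k -> bool}) (P : {ffun 'I_k -> bool} -> Prop) :
    P a ->
    (forall (b : {ffun 'I_k -> bool}) i, b i = a i -> P b -> P (flip i b)) ->
  forall b, P b.
Proof.
move=> Pa Pflip b; have [n] := ubnP #|[set j | b j != a j]|.
elim: n b => // n IH b lt_n.
have [/eqP|[i]] := set_0Vmem [set j | b j != a j].
  move=> b0; suff -> : b = a by [].
  apply/ffunP=> j; apply/eqP/negPn.
  by move/eqP/setP/(_ j): b0; rewrite !inE => ->.
rewrite inE => bi; rewrite -(flipK i b).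
have fa : flip i b i = a i.
  by rewrite flipE eqxx; case: (b i) (a i) bi => [] [].
apply: Pflip => //; apply: IH; have := card_flip fa; rewrite flipK; lia.
Qed.

(** * Medians, bipartiteness and squares *)

Section Median.

Variables (T : finType) (e : rel T).
Hypothesis G_median : median_graph e.

Local Notation d := (dist e).
Local Notation closer := (closer e).

Let e_sym : symmetric e. Proof. by case: G_median => [[]]. Qed.
Let e_irr : irreflexive e. Proof. by case: G_median => [[]]. Qed.
Let e_conn : connected_graph e. Proof. by case: G_median. Qed.
Let d_sym := dist_sym e_sym e_conn.
Let d_edge := dist_edge e_conn.
Let d_tri := dist_triangle e_conn.

Lemma edge_neq x y : e x y -> x != y.
Proof. by apply: contraTneq => ->; rewrite e_irr. Qed.

Lemma median_ex x y z : exists m, [/\ d x m + d m y = d x y,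
  d y m + d m z = d y z & d z m + d m x = d z x].
Proof.
case: G_median => _ _ /(_ x y z) /eqP /cards1P[m /setP /(_ m)].
by rewrite !inE eqxx => /andP[/andP[/eqP ? /eqP ?] /eqP ?]; exists m.
Qed.

Lemma median_uniq x y z m m' :
    [/\ d x m + d m y = d x y, d y m + d m z = d y z & d z m + d m x = d z x] ->
    [/\ d x m' + d m' y = d x y, d y m' + d m' z = d y z
      & d z m' + d m' x = d z x] ->
  m = m'.
Proof.
case: G_median => _ _ /(_ x y z) /eqP /cards1P[c /setP Ec] H H'.
have med w : [/\ d x w + d w y = d x y, d y w + d w z = d y z
    & d z w + d w x = d z x] -> w = c.
  by case=> h1 h2 h3; apply/set1P; rewrite -Ec !inE h1 h2 h3 !eqxx.
by rewrite (med _ H) (med _ H').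
Qed.

Lemma dist_edge1 x y : e x y -> d x y = 1.
Proof.
move=> xy; have := dist_edge_le xy; case E: (d x y) => [|[|]] // _.
by move: xy; rewrite (dist_eq0 e_conn E) e_irr.
Qed.

(** Bipartiteness: the median of x, y, z lies between x and y, hence is one of them, and the other
    is then one step farther from z. *)
Lemma dist_edge_neq z x y : e x y -> d z x != d z y.
Proof.
move=> xy; apply/eqP => E; have [m [h1 h2 h3]] := median_ex x y z.
have dxy := dist_edge1 xy; rewrite dxy in h1.
have [] : d x m = 0 \/ d m y = 0 by lia.
  move=> /(dist_eq0 e_conn) mx; subst m.
  by move: h2 h3; rewrite !(d_sym z) in E *; rewrite (d_sym y x); lia.
move=> /(dist_eq0 e_conn) my; subst m.
by move: h2 h3; rewrite !(d_sym z) in E *; rewrite (d_sym y x); lia.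
Qed.

Lemma closerP x y z : e x y -> closer x y z -> d z y = (d z x).+1.
Proof. by move=> /(d_edge z); rewrite /closer; lia. Qed.

Lemma closerN x y z : e x y -> closer y x z = ~~ closer x y z.
Proof. by move=> /(dist_edge_neq z); rewrite /closer; lia. Qed.

Lemma closer_refl x y : e x y -> closer x y x.
Proof. by move=> /dist_edge1; rewrite /closer distxx => ->. Qed.

Lemma four_cycleP a b c f : four_cycle e a b c f =
  [&& e a b, e b c, e c f, e f a, a != c & b != f].
Proof.
rewrite /four_cycle /= !inE !negb_or !andbT.
apply/idP/idP => [/andP[/and3P[/and3P[_ -> _] /andP[_ ->] _]]|].
  by case/and4P=> -> -> -> ->.
case/and5P=> ab bc cf fa /andP[-> ->]; rewrite ab bc cf fa !andbT.
by rewrite (edge_neq ab) (edge_neq bc) (edge_neq cf) eq_sym (edge_neq fa).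
Qed.

Lemma four_cycle_flip a b c f : four_cycle e a b c f -> four_cycle e f c b a.
Proof.
rewrite !four_cycleP => /and5P[ab bc cf fa /andP[ac bf]].
rewrite (e_sym f c) (e_sym c b) (e_sym b a) (e_sym a f).
by rewrite ab bc cf fa eq_sym bf eq_sym ac.
Qed.

Lemma four_cycle_swap a b c f : four_cycle e a b c f -> four_cycle e a f c b.
Proof.
rewrite !four_cycleP => /and5P[ab bc cf fa /andP[ac bf]].
rewrite (e_sym a f) (e_sym f c) (e_sym c b) (e_sym b a).
by rewrite ab bc cf fa ac eq_sym bf.
Qed.

Lemma dist_neighbors a x w s :
  e a x -> e a w -> x != w -> d s x = d s w -> d x w = 2.
Proof.
move=> ax aw xw E; have := d_tri a x w.
rewrite (d_sym x a) (dist_edge1 ax) (dist_edge1 aw).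
case D: (d x w) => [|[|[|]]] // _.
  by move: xw; rewrite (dist_eq0 e_conn D) eqxx.
by have := dist_edge_neq s (dist1_edge e_conn D); rewrite E eqxx.
Qed.

(** The fourth corner is the median of x, w, s: x and w are at distance 2 and equally far from s, so
    it is adjacent to both, and it differs from a because it is nearer to s. *)
Lemma quadrangle a x w s :
    e a x -> e a w -> x != w -> closer x a s -> closer w a s ->
  exists2 m, four_cycle e a x m w & d s m < d s x.
Proof.
move=> ax aw xw xs ws.
have hx := closerP (etrans (e_sym _ _) ax) xs.
have hw := closerP (etrans (e_sym _ _) aw) ws.
have dxw : d x w = 2 by apply: (@dist_neighbors a x w s) => //; lia.
have [m [h1 h2 h3]] := median_ex x w s.
rewrite dxw (d_sym m w) in h1; rewrite (d_sym m s) (d_sym w s) in h2.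
rewrite (d_sym m x) in h3.
have mx : d x m = 1 by lia.
have mw : d w m = 1 by lia.
exists m; last by lia.
rewrite four_cycleP ax (dist1_edge e_conn mx) e_sym (dist1_edge e_conn mw).
rewrite e_sym aw xw !andbT /=; apply/eqP => am; subst m.
by move: xs h3; rewrite /closer; lia.
Qed.

(** * Parallel oriented edges and squares *)

Definition parallel p q r s : Prop :=
  theta e [set p; q] [set r; s] /\ closer p q =1 closer r s.

Lemma parallel_refl p q : parallel p q p q.
Proof. by split=> //; apply: connect0. Qed.

Lemma parallel_trans p q r s t w :
  parallel p q r s -> parallel r s t w -> parallel p q t w.
Proof.
case=> th1 c1 [th2 c2]; split; first exact: connect_trans th1 th2.
by move=> z; rewrite c1 c2.
Qed.

(** Otherwise v and x are equally far from z, with u and y both one step nearer; then u and y are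
    two distinct medians of v, x, z. *)
Lemma square_closer u v y x z : four_cycle e u v y x ->
  closer u v z -> closer x y z.
Proof.
rewrite four_cycleP => /and5P[uv vy yx xu /andP[uy vx]] cu.
apply/negPn/negP => ncx.
have cy : closer y x z by rewrite closerN // e_sym.
have du := closerP uv cu; have dy := closerP yx cy.
have le1 := d_edge z vy; have le2 := d_edge z xu.
have le3 := d_edge z (etrans (e_sym _ _) xu).
have le4 := d_edge z (etrans (e_sym _ _) vy).
have E : d z v = d z x by lia.
have vu : e v u by rewrite e_sym.
have ux : e u x by rewrite e_sym.
have dvx := dist_neighbors uv ux vx E.
apply/negP: uy; apply/negPn/eqP; apply: (@median_uniq v x z);
  rewrite dvx; split; rewrite ?(d_sym x z) ?(d_sym x u) ?(d_sym x y)
    ?(d_sym u v) ?(d_sym y v)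
    ?(d_sym u z) ?(d_sym y z) ?(dist_edge1 vu) ?(dist_edge1 ux)
    ?(dist_edge1 vy) ?(dist_edge1 yx) //; lia.
Qed.

Lemma square_parallel u v y x : four_cycle e u v y x -> parallel u v x y.
Proof.
move=> sq; split.
  apply: connect1; apply/existsP; exists u; apply/existsP; exists v.
  by apply/existsP; exists x; apply/existsP; exists y; rewrite sq !eqxx.
move=> z; apply/idP/idP; first exact: square_closer.
exact: square_closer (four_cycle_flip sq).
Qed.

Lemma edgesE x y : ([set x; y] \in edges e) = e x y.
Proof.
apply/imsetP/idP => [[[a b]]|xy]; last by exists (x, y); rewrite ?inE.
by rewrite inE /= => ab /set2_inj [] [-> ->] //; rewrite e_sym.
Qed.

Lemma theta0_sym : symmetric (theta0 e).
Proof.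
suff H A B : theta0 e A B -> theta0 e B A by move=> A B; apply/idP/idP => /H.
case/existsP=> u /existsP[v /existsP[x /existsP[y /and3P[sq /eqP-> /eqP->]]]].
apply/existsP; exists x; apply/existsP; exists y; apply/existsP; exists u.
by apply/existsP; exists v; rewrite four_cycle_flip ?eqxx.
Qed.

Lemma theta_closer u v B : e u v -> theta e [set u; v] B ->
  exists x y, [/\ e x y, B = [set x; y] & closer u v =1 closer x y].
Proof.
move=> uv /connectP[p]; elim: p u v uv => [|A p IH] u v uv /=.
  by move=> _ ->; exists u, v.
case/andP=> /existsP[a /existsP[b /existsP[x /existsP[y]]]].
case/and3P=> sq /eqP Euv /eqP EA pA EB; subst A.
have [_ Cab] := square_parallel sq.
(* The same square with both edges reversed, for the case where the unordered pairs match
   crosswise. *)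
have [_ Cba] :=
  square_parallel (four_cycle_swap (four_cycle_flip (four_cycle_swap sq))).
have xy : e x y by move: sq; rewrite four_cycleP (e_sym x y) => /and5P[].
have [[ua vb]|[ub va]] := set2_inj Euv; subst a b.
  have [x' [y' [? ? c]]] := IH x y xy pA EB; exists x', y'; split => // z.
  by rewrite Cab c.
have yx : e y x by rewrite e_sym.
rewrite [X in path _ X _]setUC in pA; rewrite [X in last X _]setUC in EB.
have [x' [y' [? ? c]]] := IH y x yx pA EB; exists x', y'; split => // z.
by rewrite -c; apply: Cba.
Qed.

(** * Theta-classes and their halfspaces *)

Lemma theta_equivalence : {in edges e & &, equivalence_rel (theta e)}.
Proof.
move=> A B C _ _ _; split; first exact: connect0.
by move=> AB; apply: (same_connect (sym_connect_sym theta0_sym)).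
Qed.

Lemma theta_classes_partition : partition (theta_classes e) (edges e).
Proof. exact: equivalence_partitionP theta_equivalence. Qed.

Lemma class_uniq A C D : C \in theta_classes e -> D \in theta_classes e ->
  A \in C -> A \in D -> C = D.
Proof.
have /and3P[_ tI _] := theta_classes_partition => CP DP AC AD.
by rewrite -(def_pblock tI CP AC) (def_pblock tI DP AD).
Qed.

Lemma class_edges C A : C \in theta_classes e -> A \in C -> A \in edges e.
Proof.
have /and3P[/eqP <- _ _] := theta_classes_partition => CP AC.
by apply/bigcupP; exists C.
Qed.

Lemma class_edge C x y : C \in theta_classes e -> [set x; y] \in C -> e x y.
Proof. by move=> CP /(class_edges CP); rewrite edgesE. Qed.

Lemma edge_class x y : e x y ->
  exists2 C, C \in theta_classes e & [set x; y] \in C.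
Proof.
rewrite -edgesE; have /and3P[/eqP <- _ _] := theta_classes_partition.
by case/bigcupP=> C; exists C.
Qed.

Lemma class_theta C A B : C \in theta_classes e -> A \in C ->
  B \in edges e -> (B \in C) = theta e A B.
Proof.
move=> CP AC BE; have /and3P[_ tI _] := theta_classes_partition.
rewrite -(def_pblock tI CP AC).
rewrite (pblock_equivalence_partition theta_equivalence) //.
exact: class_edges AC.
Qed.

Lemma class_parallel C p q r s : C \in theta_classes e ->
  parallel p q r s -> e r s -> [set p; q] \in C -> [set r; s] \in C.
Proof. by move=> CP [th _] rs pC; rewrite (class_theta CP pC) ?edgesE. Qed.

(** Move u one step to u' towards x. Both v and u' are nearer to y than u is, so they span a square
    with u; its edge opposite to uv has the same sides and starts one step nearer to x. *)
Lemma crossing_theta u v x y : e u v -> e x y -> closer u v x -> closer v u y ->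
  theta e [set u; v] [set x; y].
Proof.
move: {2}(d u x) (erefl (d u x)) => n.
elim: n u v => [|n IH] u v dux uv xy cx cy.
  have ? := dist_eq0 e_conn dux; subst x.
  have := closerP uv cx; have vu : e v u by rewrite e_sym.
  have := closerP vu cy; have := dist_edge1 xy; rewrite (d_sym u y) distxx.
  move=> -> [/esym/(dist_eq0 e_conn) ->] _; exact: connect0.
have vu : e v u by rewrite e_sym.
have yx : e y x by rewrite e_sym.
have h1 := closerP uv cx; have h2 := closerP vu cy.
have [u' uu' du'] := dist_step e_conn dux.
have := d_edge u xy; have := d_edge v yx; have := d_edge u' xy.
rewrite !(d_sym x) in h1; rewrite !(d_sym y) in h2.
move=> k1 k2 k3.
(* The inequalities force d(u,y) = n+2 and d(v,y) = n+1, so u' is also a first step from u towards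
   y. *)
have hu' : d y u' = n.+1.
  have := d_edge y (etrans (e_sym _ _) uu').
  by rewrite (d_sym y u) (d_sym y u'); lia.
have u'v : v != u' by apply/eqP => ?; subst u'; lia.
have cu' : closer u' u y by rewrite /closer (d_sym y u); lia.
have [m sq dm] := quadrangle uv uu' u'v cy cu'.
have := sq; rewrite four_cycleP => /and5P[_ vm mu' _ /andP[_ _]].
have par := square_parallel sq.
have [th c] := par.
apply: connect_trans th _; apply: (IH u' m) => //; first by rewrite e_sym.
  by rewrite -c.
by rewrite closerN ?(e_sym u') // -c -closerN.
Qed.

(** Along a chain of squares the sides are preserved ([theta_closer]), and an edge that changes side
    is reached by such a chain ([crossing_theta]). *)
Lemma class_closer C p q r t : C \in theta_classes e -> [set p; q] \in C ->
  e r t -> ([set r; t] \in C) = (closer p q r != closer p q t).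
Proof.
move=> CP pC rt; have pq := class_edge CP pC.
have tr : e t r by rewrite e_sym.
have rtE : [set r; t] \in edges e by rewrite edgesE.
rewrite (class_theta CP pC) //; apply/idP/idP => [|neq].
  case/(theta_closer pq) => r' [t' [_ /set2_inj [] [? ?] c]]; subst r' t'.
    by rewrite !c closer_refl // (closerN t tr) closer_refl.
  by rewrite !c closer_refl // (closerN r rt) closer_refl.
case cr: (closer p q r) neq => /= ct.
  by apply: crossing_theta => //; rewrite closerN.
rewrite [X in theta _ _ X]setUC; apply: crossing_theta => //.
  by case: (closer p q t) ct.
by rewrite closerN ?cr.
Qed.

(** A geodesic from x to p stays in W(p,q), hence uses no edge of C. *)
Lemma halfspace_connect C p q x : C \in theta_classes e -> [set p; q] \in C ->
  closer p q x -> connect (remove_class e C) x p.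
Proof.
move=> CP pC; have pq := class_edge CP pC.
move: {2}(d x p) (erefl (d x p)) => n; elim: n x => [|n IH] x dx cx.
  by rewrite (dist_eq0 e_conn dx) connect0.
have [z xz dz] := dist_step e_conn dx.
have cz : closer p q z.
  have := d_edge q (etrans (e_sym _ _) xz); have := closerP pq cx.
  by rewrite /closer !(d_sym q); lia.
apply: connect_trans (IH z dz cz); apply: connect1.
by rewrite /remove_class xz (class_closer CP pC) // cx cz.
Qed.

(** The components left by removing C are W(p,q) and W(q,p): a walk avoiding C never changes side,
    and each side is connected to its end of pq. *)
Lemma separatesE C p q x y : C \in theta_classes e -> [set p; q] \in C ->
  separates e C x y = (closer p q x != closer p q y).
Proof.
move=> CP pC; have pq := class_edge CP pC.
have rsym : connect_sym (remove_class e C).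
  by apply: sym_connect_sym => a b; rewrite /remove_class e_sym setUC.
apply/idP/idP; last first.
  apply: contra => /connectP[s xs ->] {y}; elim: s x xs => //= a s IH x.
  case/andP=> /andP[xa]; rewrite (class_closer CP pC) // negbK => /eqP ->.
  exact: IH.
apply: contra => /eqP; case cx: (closer p q x) => /esym cy.
  have cxp := halfspace_connect CP pC cx.
  by apply: connect_trans cxp _; rewrite rsym (halfspace_connect CP pC cy).
have qC : [set q; p] \in C by rewrite setUC.
have {}cx : closer q p x by rewrite closerN ?cx.
have {}cy : closer q p y by rewrite closerN ?cy.
apply: connect_trans (halfspace_connect CP qC cx) _.
by rewrite rsym (halfspace_connect CP qC cy).
Qed.

(** As x lies on its own side of xz, separating x from y means that y lies on the side of z; ladder
    sets thereby become a matter of distances. *)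
Lemma ladderP C x y : reflect
  (C \in theta_classes e /\ exists2 z, [set x; z] \in C & closer z x y)
  (C \in ladder e x y).
Proof.
rewrite !inE; apply: (iffP andP) => [[/andP[CP sep] /existsP[A /andP[AC xA]]]|].
  split=> //; have /imsetP[[a b]] := class_edges CP AC.
  rewrite inE /= => ab EA; subst A.
  have [z Ez] : exists z, [set a; b] = [set x; z].
    move: xA; rewrite !inE => /orP[] /eqP ->; first by exists b.
    by exists a; rewrite setUC.
  rewrite Ez in AC; exists z => //; have xz := class_edge CP AC.
  by move: sep; rewrite (separatesE _ _ CP AC) closer_refl // (closerN _ xz).
case=> CP [z zC cz]; have xz := class_edge CP zC; split.
  by rewrite CP (separatesE _ _ CP zC) closer_refl // -(closerN _ xz).
by apply/existsP; exists [set x; z]; rewrite zC set21.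
Qed.

Lemma ladder_closer C x y z : C \in ladder e x y -> [set x; z] \in C ->
  closer z x y.
Proof.
rewrite !inE -andbA => /and3P[CP sep _] zC; have xz := class_edge CP zC.
by move: sep; rewrite (separatesE _ _ CP zC) closer_refl // (closerN _ xz).
Qed.

(** The square witnessing orthogonality may be far from a, but its corners realize all four
    combinations of sides. One corner is on the side of both x and w, and [quadrangle] applies with
    it as target. *)
Lemma orthogonal_square C D a x w :
    C \in theta_classes e -> D \in theta_classes e -> C != D ->
    orthogonal e C D -> [set a; x] \in C -> [set a; w] \in D ->
  exists m, four_cycle e a x m w.
Proof.
move=> CP DP CD orth xC wD.
have ax := class_edge CP xC; have aw := class_edge DP wD.
have xw : x != w.
  by apply: contraNneq CD => ?; subst w; apply/eqP/(class_uniq CP DP xC).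
suff [s xs ws] : exists2 s, closer x a s & closer w a s.
  by have [m] := quadrangle ax aw xw xs ws; exists m.
have in1 A : A \in C -> A \notin D.
  by move=> inC; apply: contra CD => inD; apply/eqP/(class_uniq CP DP inC).
have in2 A : A \in D -> A \notin C by move=> AD; apply: contraL AD => /in1.
case/existsP: orth => u /existsP[v /existsP[s /existsP[t]]].
rewrite four_cycleP => /and5P[/and5P[uv vt ts su /andP[_ _]] uvC stC usD vtD].
have us : e u s by rewrite e_sym.
have st : e s t by rewrite e_sym.
rewrite setUC in xC; rewrite setUC in wD.
have := in2 _ vtD; have := in2 _ usD; have := in1 _ uvC.
move: uvC usD vtD; rewrite !(class_closer CP xC) // !(class_closer DP wD) //.
rewrite !negbK => gv hs ht /eqP huv /eqP gus /eqP gvt.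
case gu: (closer x a u) gv gus; case hu: (closer w a u) hs huv => hs huv gv gus.
- by exists u.
- by exists s; [rewrite -gus | case: (closer w a s) hs].
- by exists v; [case: (closer x a v) gv | rewrite -huv].
- exists t; first by rewrite -gvt; case: (closer x a v) gv.
  by move: ht; rewrite -huv; case: (closer w a t).
Qed.

(** * Induced hypercubes in a median graph *)

Section Cube.

Variables (k : nat) (f : {ffun 'I_k -> bool} -> T).
Hypothesis f_inj : injective f.
Hypothesis f_adj : forall a b, e (f a) (f b) = (#|[set i | a i != b i]| == 1).
Implicit Types a b c : {ffun 'I_k -> bool}.

Lemma cube_edge a i : e (f a) (f (flip i a)).
Proof.
rewrite f_adj; apply/cards1P; exists i; apply/setP=> j.
by rewrite !inE flipE; case: (j == i) (a j) => [] [].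
Qed.

Lemma cube_edge_flip a b : e (f a) (f b) -> exists i, b = flip i a.
Proof.
rewrite f_adj => /cards1P[i /setP E]; exists i; apply/ffunP=> j.
by have := E j; rewrite !inE flipE => <-; case: (a j) (b j) => [] [].
Qed.

Lemma cube_square a i j : i != j ->
  four_cycle e (f a) (f (flip i a)) (f (flip j (flip i a))) (f (flip j a)).
Proof.
move=> ij; rewrite four_cycleP !cube_edge flipC.
rewrite e_sym cube_edge e_sym cube_edge /=.
apply/andP; split; apply: contraNneq ij => /f_inj/ffunP/(_ i);
  rewrite !flipE eqxx; by case: (i == j) (a i) => [] [].
Qed.

(** Flipping another coordinate passes to the opposite edge of a square; equality at i fixes the
    orientation. *)
Lemma cube_parallel a b i : b i = a i ->
  parallel (f a) (f (flip i a)) (f b) (f (flip i b)).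
Proof.
move: b; apply: (cube_ind (a := a)) => [_|b j bj IH].
  exact: parallel_refl.
rewrite flipE; case: eqVneq => [->|ij /= bi].
  by rewrite bj; case: (a j).
apply: parallel_trans (IH bi) _; rewrite flipC.
by apply: square_parallel; apply: cube_square.
Qed.

(** Here [f a] is the gate of z in the cube: by parallelism each direction keeps leading away from z
    at every vertex. *)
Lemma cube_dist_away z a b : (forall i, closer (f a) (f (flip i a)) z) ->
  d z (f b) = d z (f a) + #|[set j | b j != a j]|.
Proof.
move=> H; move: b; apply: (cube_ind (a := a)) => [|b i bi IH].
  by rewrite eq_card0 ?addn0 // => j; rewrite !inE eqxx.
rewrite card_flip // addnS -IH; apply: closerP; first exact: cube_edge.
by have [_ <-] := cube_parallel bi.
Qed.

Lemma cube_dist_toward z a b : (forall i, closer (f (flip i a)) (f a) z) ->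
  d z (f b) + #|[set j | b j != a j]| = d z (f a).
Proof.
move=> H; move: b; apply: (cube_ind (a := a)) => [|b i bi IH].
  by rewrite eq_card0 ?addn0 // => j; rewrite !inE eqxx.
rewrite card_flip // addnS -IH -addSn; congr (_ + _); apply/esym.
have bb := cube_edge b i; apply: closerP; first by rewrite e_sym.
rewrite closerN //; have [_ <-] := cube_parallel bi.
by rewrite -closerN // cube_edge.
Qed.

Lemma cube_dist a b : d (f a) (f b) = #|[set j | b j != a j]|.
Proof.
rewrite (@cube_dist_away (f a) a) ?distxx // => i.
exact: closer_refl (cube_edge a i).
Qed.

Lemma cube_class C A a : C \in theta_classes e -> A \in C ->
    A \subset [set f b | b in {ffun 'I_k -> bool}] ->
  exists i, [set f a; f (flip i a)] \in C.
Proof.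
move=> CP AC; have /imsetP[[p q]] := class_edges CP AC.
rewrite inE /= => pq EA; subst A; rewrite subUset !sub1set.
case/andP=> /imsetP[b _ Eb] /imsetP[c _ Ec]; subst p q.
have [i Ec] := cube_edge_flip pq; subst c; exists i.
have aa := cube_edge a i.
case: (eqVneq (a i) (b i)) => [E|neq].
  exact: class_parallel (cube_parallel E) aa AC.
(* If a and b disagree at i, the edge is read from its other end. *)
have E : a i = flip i b i.
  by rewrite flipE eqxx; case: (a i) (b i) neq => [] [].
apply: class_parallel (cube_parallel E) aa _ => //.
by rewrite flipK setUC.
Qed.

(** At each cube edge, orthogonality supplies a square that carries the edge of C across. *)
Lemma cube_transport C a b x : C \in theta_classes e ->
    (forall c i D, D \in theta_classes e -> [set f c; f (flip i c)] \in D ->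
       C != D /\ orthogonal e C D) ->
    [set f a; x] \in C ->
  exists2 y, [set f b; y] \in C & closer (f a) x =1 closer (f b) y.
Proof.
move=> CP orth xC; move: b; apply: (cube_ind (a := a)) => [|b i _ [y yC cy]].
  by exists x.
have [D DP bD] := edge_class (cube_edge b i).
have [CD oCD] := orth b i D DP bD.
have [m sq] := orthogonal_square CP DP CD oCD yC bD.
have par := square_parallel sq.
exists m; last by case: par => _ c z; rewrite cy c.
apply: class_parallel par _ yC => //.
by move: sq; rewrite four_cycleP (e_sym m) => /and5P[].
Qed.

End Cube.

(** * Nested intervals and orthogonality inside a ladder set *)

Lemma interval_trans x y z w : y \in interval e x w -> z \in interval e y w ->
  z \in interval e x w.
Proof.
rewrite !inE => /eqP h1 /eqP h2.
by have := d_tri y x z; have := d_tri z x w; lia.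
Qed.

Lemma interval_nested x y z w : z \in interval e x w -> y \in interval e x z ->
  (y \in interval e x w) && (z \in interval e y w).
Proof.
rewrite !inE => /eqP h1 /eqP h2.
by have := d_tri z y w; have := d_tri y x w; lia.
Qed.

Lemma ladder_orthogonal C D x y : C \in ladder e x y -> D \in ladder e x y ->
  C != D -> orthogonal e C D.
Proof.
move=> /ladderP[CP [p pC cp]] /ladderP[DP [q qD cq]] CD.
have xp := class_edge CP pC; have xq := class_edge DP qD.
have pq : p != q.
  by apply: contraNneq CD => ?; subst q; apply/eqP/(class_uniq CP DP pC).
have [m sq _] := quadrangle xp xq pq cp cq.
have sq' := four_cycle_swap sq.
have := sq; rewrite four_cycleP => /and5P[_ pm mq _ /andP[_ _]].
apply/existsP; exists x; apply/existsP; exists p; apply/existsP; exists q.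
apply/existsP; exists m; rewrite sq pC qD /=; apply/andP; split.
  by apply: class_parallel (square_parallel sq) _ pC; rewrite // e_sym.
exact: class_parallel (square_parallel sq') pm qD.
Qed.

End Median.

(** * Ladder sets at the basis and at the anti-basis *)

Theorem theorem5 (T : finType) (e : rel T) (v0 : T)
    (G_median : median_graph e)
    (u : T) (L : {set {set {set T}}})
    (L_POF : POF e L) (L_out : outgoing e v0 L u)
    (Q : {set T}) (Q_cube : hypercube_with e v0 u L Q)
    (up : T) (up_anti : anti_basis e v0 Q up)
    (v : T) (v_neq_up : v <> up) :
  (u \in interval e v0 v /\ ladder e u v = L)
  <->
  (up \in interval e v0 v /\
   forall Ej : {set {set T}}, Ej \in ladder e up v -> ~ POF e (L :|: [set Ej])).
Proof.
case: Q_cube => [[k [f [f_inj EQ f_adj]]] [uQ u_min] sigQ].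
case: up_anti => upQ up_max; case: (G_median) => [[e_sym _] e_conn _].
have d_sym := dist_sym e_sym e_conn; have d_tri := dist_triangle e_conn.
have fQ a : f a \in Q by rewrite -EQ; apply: imset_f.
have /imsetP[a _ Eu] : u \in f @: predT by rewrite EQ.
have /imsetP[b _ Eup] : up \in f @: predT by rewrite EQ.
subst u up.
have edge := cube_edge f_adj; have neq := dist_edge_neq G_median.
have v0_away i : closer e (f a) (f (flip i a)) v0.
  by rewrite /closer ltn_neqAle neq ?edge // u_min.
have v0E c := cube_dist_away G_median f_inj f_adj c v0_away.
(* Distance from [v0] grows with Hamming distance from a, so the farthest vertex differs from a in
   every coordinate, as the antipode does. *)
have bE i : b i = ~~ a i.
  have := up_max _ (fQ [ffun j => ~~ a j]); rewrite (v0E b) v0E leq_add2l => le.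
  have /setP/(_ i) : [set j | b j != a j] = setT.
    apply/eqP; rewrite eqEcard subsetT; apply: leq_trans le.
    by apply/subset_leq_card/subsetP=> j _; rewrite inE ffunE; case: (a j).
  by rewrite !inE; case: (b i) (a i) => [] [].
have ab0 : f a \in interval e v0 (f b).
  by rewrite inE (cube_dist G_median f_inj f_adj) -v0E.
(* The i-edge at a is parallel to the i-edge at b read backwards, since [flip i b] agrees with a at
   i. *)
have b_toward i : closer e (f (flip i a)) (f a) (f b).
  have E : flip i b i = a i by rewrite flipE eqxx bE; case: (a i).
  have [_ c] := cube_parallel G_median f_inj f_adj E.
  rewrite (closerN G_median) ?edge // c flipK -(closerN G_median).
    by apply: (closer_refl G_median); rewrite ?edge.
  by rewrite e_sym.
have edgeL c i D : D \in theta_classes e ->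
    [set f c; f (flip i c)] \in D -> D \in L.
  move=> DP cD; rewrite -sigQ inE DP; apply/existsP.
  by exists [set f c; f (flip i c)]; rewrite cD subUset !sub1set !fQ.
have LP C : C \in L -> C \in theta_classes e.
  by case/andP: L_POF => /subsetP H _; apply: H.
have L_edge C : C \in L -> exists i, [set f a; f (flip i a)] \in C.
  rewrite -sigQ inE => /andP[CP /existsP[A /andP[AC AQ]]].
  by apply: (cube_class G_median f_inj f_adj a CP AC); rewrite EQ.
(* The cube vertices are arbitrary because the slide is used both from b to a and from a to b. *)
have slide c1 c2 C : C \in theta_classes e -> C \notin L ->
    POF e (L :|: [set C]) -> C \in ladder e (f c1) v -> C \in ladder e (f c2) v.
  move=> CP CL /andP[_ /forall_inP pof] /(ladderP G_median)[_ [x xC cx]].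
  have orth c i D : D \in theta_classes e -> [set f c; f (flip i c)] \in D ->
      C != D /\ orthogonal e C D.
    move=> DP /(edgeL _ _ _ DP) DL.
    have CD : C != D by apply: contraNneq CL => ->.
    split=> //; have CLC : C \in L :|: [set C] by rewrite !inE eqxx orbT.
    have /forall_inP/(_ D) := pof C CLC.
    by rewrite !inE DL CD => /(_ isT).
  have [y yC cy] := cube_transport G_median f_adj c2 CP orth xC.
  apply/(ladderP G_median); split=> //; exists y => //.
  rewrite (closerN G_median) ?(class_edge G_median CP yC) // -cy.
  by rewrite -(closerN G_median) // (class_edge G_median CP xC).
split=> [[uI EL]|[upI noPOF]].
- have v_toward i : closer e (f (flip i a)) (f a) v.
    have [D DP iD] := edge_class G_median (edge a i).
    have := edgeL _ _ _ DP iD; rewrite -EL => DL.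
    exact: (ladder_closer G_median DL iD).
  have bI : f b \in interval e (f a) v.
    rewrite inE (cube_dist G_median f_inj f_adj) !(d_sym _ v) addnC.
    by rewrite (cube_dist_toward G_median f_inj f_adj b v_toward).
  split; first exact: (interval_trans G_median uI bI).
  move=> C Cup pof; have /(ladderP G_median)[CP _] := Cup.
  (* A class of L separates [f a] from both [f b] and v, hence does not separate [f b] from v. *)
  have CL : C \notin L.
    apply/negP=> /L_edge[i iC]; move: (Cup).
    rewrite setUC in iC.
    by rewrite !inE CP (separatesE G_median _ _ CP iC) b_toward v_toward.
  by have := slide b a C CP CL pof Cup; rewrite EL (negPf CL).
- have /andP[aI bI] := interval_nested G_median upI ab0; split=> //.
  have Lsub C : C \in L -> C \in ladder e (f a) v.
    move=> CL; apply/(ladderP G_median); split; first exact: LP.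
    have [i iC] := L_edge C CL; exists (f (flip i a)) => //.
    (* Since [f b] is on a geodesic from [f a] to v, a neighbour of [f a] nearer to [f b] is also
       nearer to v. *)
    move: bI (b_toward i); rewrite inE /closer => /eqP.
    have := d_tri (f b) v (f (flip i a)).
    by rewrite !(d_sym v) !(d_sym (f b) (f _)) (d_sym (f b) v); lia.
  apply/setP=> C; apply/idP/idP=> [Cl|]; last exact: Lsub.
  apply: contraT => CL; have CP : C \in theta_classes e.
    by case/(ladderP G_median): Cl.
  (* All these classes lie in the single ladder set at [f a], so they are pairwise orthogonal. *)
  have pof : POF e (L :|: [set C]).
    apply/andP; split.
      by apply/subsetP=> D; rewrite !inE => /orP[/LP|/eqP ->].
    have lad D : D \in L :|: [set C] -> D \in ladder e (f a) v.
      by rewrite in_setU in_set1 => /orP[/Lsub|/eqP ->].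
    apply/forall_inP=> D /lad DI; apply/forall_inP=> D' /lad DI'.
    by apply/implyP; apply: (ladder_orthogonal G_median DI DI').
  by case: (noPOF C (slide a b C CP CL pof Cl)).
Qed.
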